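(* Consider a mixed-autonomy routing instance with affine latencies $c_i(z_i)=\sum_{j\in[m]}a_i^j z_i^j+b_i$ on a general network, with maximum degree of asymmetry $k$. Let $z^*$ be a socially optimal routing. On each road $i\in[n]$ levy the following identical fixed toll for all vehicle types $j\in[m]$: $$\tau_i^j=\Big(\min_{j'\in[m]}a_i^{j'}\Big)\sum_{l\in[m]}z_i^{*l}.$$ Then any Wardrop Equilibrium $\hat z$ relative to these tolls satisfies $$C(\hat z)\le\frac{4k}{3k+1}\,k\,C(z^* ).$$
   Context: Network: a finite directed graph (parallel edges allowed) with $n$ edges (roads), indexed by $i\in[n]=\{1,\dots,n\}$; there are $m$ vehicle types indexed by $j\in[m]$. Flow is nonatomic. Demand is inelastic and given by finitely many commodities $r\in[R]$, each with a source node $s_r$, destination node $s'_r$, demand $\beta_r\ge 0$ and vehicle type $j_r\in[m]$; $\mathcal P_r$ is the set of simple paths from $s_r$ to $s'_r$. A feasible path flow assigns $f_{r,p}\ge0$ to each $r\in[R]$, $p\in\mathcal P_r$ with $\sum_{p\in\mathcal P_r}f_{r,p}=\beta_r$. It induces the edge routing $z=(z_i^j)$, where $z_i^j=\sum_{r:\,j_r=j}\ \sum_{p\in\mathcal P_r:\,i\in p}f_{r,p}$ is the flow of type $j$ on road $i$. Write $z_i=(z_i^1,\dots,z_i^m)^T$. The set $\mathcal Z$ of feasible routings is the set of edge routings induced by feasible path flows. Latency: on road $i$ all vehicle types experience the same latency $c_i(z_i)=\sum_{j\in[m]}a_i^jz_i^j+b_i$ with $a_i^j\ge0$, $b_i\ge0$.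 Social cost (tolls not counted): $C(z)=\sum_{i\in[n]}\big(\sum_{j\in[m]}z_i^j\big)c_i(z_i)$. A socially optimal routing $z^*$ is a minimizer of $C$ over $\mathcal Z$. Given tolls $\tau_i^j$, a user of type $j$ on road $i$ experiences cost $c_i(z_i)+\tau_i^j$. A feasible routing $z$ is a Wardrop Equilibrium relative to $\tau$ if it is induced by a feasible path flow $f$ such that for all $r\in[R]$ and all $p,p'\in\mathcal P_r$: $f_{r,p}>0$ implies $\sum_{i\in p}(c_i(z_i)+\tau_i^{j_r})\le\sum_{i\in p'}(c_i(z_i)+\tau_i^{j_r})$. The maximum degree of asymmetry is $k=\max_{i\in[n],\,j,j'\in[m]}a_i^j/a_i^{j'}$ (so $k\ge1$), assumed finite; on a road where all $a_i^j$ are zero the ratio is taken to be $1$. Thus $a_i^j\le k\,a_i^{j'}$ for all $i,j,j'$. *)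

(* Defs.v *)
From mathcomp Require Import all_boot all_order all_algebra.
From mathcomp Require Import reals.

Set Implicit Arguments.
Unset Strict Implicit.
Unset Printing Implicit Defensive.

Import Order.TTheory GRing.Theory Num.Theory.
Local Open Scope ring_scope.

(* The edges are the elements of 'I_n, so parallel edges are allowed; the
   latency of road i is \sum_j lat_slope i j * z i j + lat_const i. *)
Record routing_instance (R : realType) (n m : nat) := RoutingInstance {
  node : finType;
  edge_tail : 'I_n -> node;
  edge_head : 'I_n -> node;
  ncommodity : nat;
  origin : 'I_ncommodity -> node;
  destination : 'I_ncommodity -> node;
  demand : 'I_ncommodity -> R;
  vehicle_type : 'I_ncommodity -> 'I_m;
  lat_slope : 'I_n -> 'I_m -> R;
  lat_const : 'I_n -> R;
  demand_ge0 : forall r, 0 <= demand r;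
  lat_slope_ge0 : forall i j, 0 <= lat_slope i j;
  lat_const_ge0 : forall i, 0 <= lat_const i
}.

Section Routing.
Variables (R : realType) (n m : nat) (G : routing_instance R n m).

Fixpoint is_walk (x y : node G) (p : seq 'I_n) : bool :=
  if p is e :: p' then (edge_tail G e == x) && is_walk (edge_head G e) y p'
  else x == y.

Definition is_simple_path (x y : node G) (p : seq 'I_n) : bool :=
  is_walk x y p && uniq (x :: map (edge_head G) p).

(* A simple path repeats no edge, so it has at most n edges and the finite
   type {bseq n of 'I_n} contains all of them. *)
Lemma size_simple_path (x y : node G) (p : seq 'I_n) :
  is_simple_path x y p -> (size p <= n)%N.
Proof.
case/andP=> _ /= /andP[_ /map_uniq Up].
by rewrite -[leqRHS]card_ord -(card_uniqP Up) max_card.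
Qed.

Definition simple_paths (r : 'I_(ncommodity G)) : {set {bseq n of 'I_n}} :=
  [set p : {bseq n of 'I_n} |
    is_simple_path (origin r) (destination r) p].

(* Only the values f r p with p \in simple_paths r are meaningful. *)
Definition path_flow := 'I_(ncommodity G) -> {bseq n of 'I_n} -> R.

Definition feasible_path_flow (f : path_flow) : Prop :=
  (forall r p, p \in simple_paths r -> 0 <= f r p) /\
  (forall r, \sum_(p in simple_paths r) f r p = demand r).

Definition induced_routing (f : path_flow) : 'M[R]_(n, m) :=
  \matrix_(i < n, j < m)
    \sum_(r | vehicle_type r == j)
      \sum_(p in simple_paths r | i \in p) f r p.

Definition feasible_routing (z : 'M[R]_(n, m)) : Prop :=
  exists2 f : path_flow, feasible_path_flow f & z = induced_routing f.

Definition latency (z : 'M[R]_(n, m)) (i : 'I_n) : R :=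
  \sum_(j < m) lat_slope G i j * z i j + lat_const G i.

Definition social_cost (z : 'M[R]_(n, m)) : R :=
  \sum_(i < n) (\sum_(j < m) z i j) * latency z i.

Definition socially_optimal (z : 'M[R]_(n, m)) : Prop :=
  feasible_routing z /\
  forall z', feasible_routing z' -> social_cost z <= social_cost z'.

Definition path_cost (tau : 'I_n -> 'I_m -> R) (z : 'M[R]_(n, m))
    (j : 'I_m) (p : {bseq n of 'I_n}) : R :=
  \sum_(i in p) (latency z i + tau i j).

Definition wardrop_equilibrium (tau : 'I_n -> 'I_m -> R)
    (z : 'M[R]_(n, m)) : Prop :=
  exists f : path_flow,
    [/\ feasible_path_flow f, z = induced_routing f &
        forall r p p', p \in simple_paths r -> p' \in simple_paths r ->
          0 < f r p ->
          path_cost tau z (vehicle_type r) p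
            <= path_cost tau z (vehicle_type r) p'].

Definition asymmetry_ratio (i : 'I_n) (j j' : 'I_m) : R :=
  if [forall l, lat_slope G i l == 0] then 1
  else lat_slope G i j / lat_slope G i j'.

(* No ratio has a positive numerator over a zero denominator. This has to be
   required separately because division by 0 is total in MathComp. *)
Definition finite_asymmetry : Prop :=
  forall i j j', 0 < lat_slope G i j -> 0 < lat_slope G i j'.

(* The ratios with j = j' equal 1 under finite_asymmetry, so starting the
   maxima at 1 does not change their value. *)
Definition max_asymmetry : R :=
  \big[Num.max/1]_(i < n) \big[Num.max/1]_(j < m) \big[Num.max/1]_(j' < m)
    asymmetry_ratio i j j'.

Lemma asymmetry_ratioP (i : 'I_n) (j j' : 'I_m) : finite_asymmetry ->
  lat_slope G i j <= max_asymmetry * lat_slope G i j'.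
Proof.
move=> fin; have le_k : asymmetry_ratio i j j' <= max_asymmetry.
  apply: le_trans (le_bigmax _ _ i); apply: le_trans (le_bigmax _ _ j).
  exact: (le_bigmax _ _ j').
have [a0|a_neq0] := eqVneq (lat_slope G i j') 0.
  rewrite a0 mulr0 leNgt; apply/negP => /(fin i j j').
  by rewrite a0 ltxx.
have a_gt0 : 0 < lat_slope G i j' by rewrite lt0r a_neq0 lat_slope_ge0.
rewrite -ler_pdivrMr //; move: le_k; rewrite /asymmetry_ratio.
by case: ifP => // /forallP/(_ j'); rewrite (negPf a_neq0).
Qed.

(* The minimum is over a nonempty family because j : 'I_m; it is started at
   lat_slope i j, one of its terms, so it does not depend on j. *)
Definition toll (z : 'M[R]_(n, m)) (i : 'I_n) (j : 'I_m) : R :=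
  (\big[Num.min/lat_slope G i j]_(j' < m) lat_slope G i j')
    * \sum_(l < m) z i l.

Lemma toll_identical (z : 'M[R]_(n, m)) (i : 'I_n) (j1 j2 : 'I_m) :
  toll z i j1 = toll z i j2.
Proof.
rewrite /toll; congr (_ * _); apply/le_anti/andP.
by split; apply: le_bigmin => [|l _]; apply: bigmin_le.
Qed.

End Routing.

(* Main.v *)
Require Import Defs.
From mathcomp Require Import all_boot all_order all_algebra.
From mathcomp Require Import reals.
From mathcomp Require Import lra.

Set Implicit Arguments.
Unset Strict Implicit.
Unset Printing Implicit Defensive.

Import Order.TTheory GRing.Theory Num.Theory.
Local Open Scope ring_scope.

(* An equilibrium satisfies the variational inequality
   \sum_ij zeq_i^j (c_i(zeq_i) + tau_i^j) <= \sum_ij z_i^j (c_i(zeq_i) + tau_i^j)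
   for every feasible z.  Subtracting 2k/(k+1) times it (for z = zopt) from the
   social cost leaves one inequality per road, which follows from AM-GM and
   gives the bound k * C(zopt); this is stronger than the announced one because
   4k >= 3k + 1. *)

Section VariationalInequality.
Variables (R : realType) (n m : nat) (G : routing_instance R n m).

(** Exchanging the sums over roads and paths turns an edge-wise total into path costs, the form in
    which the equilibrium condition is stated. *)
Lemma induced_routing_weighted_sum (f : path_flow G) (w : 'I_n -> 'I_m -> R) :
  \sum_i \sum_j induced_routing f i j * w i j =
  \sum_r \sum_(p in simple_paths r)
    f r p * \sum_(i in p) w i (vehicle_type r).
Proof.
transitivity (\sum_i \sum_r \sum_(p in simple_paths r | i \in p)
    f r p * w i (vehicle_type r)).
  apply: eq_bigr => i _.
  rewrite [RHS](partition_big (@vehicle_type _ _ _ G) xpredT) //=.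
  apply: eq_bigr => j _; rewrite mxE mulr_suml.
  by apply: eq_bigr => r /eqP <-; rewrite mulr_suml.
rewrite exchange_big /=; apply: eq_bigr => r _.
rewrite (exchange_big_dep (mem (simple_paths r))) /=; last
  by move=> i p _ /andP[].
apply: eq_bigr => p pr; rewrite mulr_sumr.
by apply: eq_bigl => i; rewrite pr.
Qed.

Lemma feasible_routing_ge0 (z : 'M[R]_(n, m)) (i : 'I_n) (j : 'I_m) :
  feasible_routing G z -> 0 <= z i j.
Proof.
case=> f [f_ge0 _] ->; rewrite mxE.
by apply: sumr_ge0 => r _; apply: sumr_ge0 => p /andP[/f_ge0].
Qed.

Lemma wardrop_feasible (tau : 'I_n -> 'I_m -> R) (z : 'M[R]_(n, m)) :
  wardrop_equilibrium G tau z -> feasible_routing G z.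
Proof. by case=> f [hf hz _]; exists f. Qed.

(** With costs frozen at [z], the equilibrium flow uses only cheapest paths, while any other flow
    meeting the same demands pays at least the cheapest cost. *)
Lemma wardrop_variational_inequality (tau : 'I_n -> 'I_m -> R)
    (z z' : 'M[R]_(n, m)) :
  wardrop_equilibrium G tau z -> feasible_routing G z' ->
  \sum_i \sum_j z i j * (latency G z i + tau i j)
    <= \sum_i \sum_j z' i j * (latency G z i + tau i j).
Proof.
case=> f [[f_ge0 f_demand] zE f_min] [g [g_ge0 g_demand] ->].
(* Only the [z] acting as flow is expanded; the one inside [latency] stays. *)
rewrite [in leLHS](_ : \sum_i _ = \sum_i \sum_j induced_routing f i j *
  (latency G z i + tau i j)); last by rewrite -zE.
rewrite !(induced_routing_weighted_sum _ (fun i j => latency G z i + tau i j)).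
apply: ler_sum => r _.
pose L p := path_cost G tau z (vehicle_type r) p.
rewrite -[leLHS]/(\sum_(p in simple_paths r) f r p * L p).
rewrite -[leRHS]/(\sum_(p in simple_paths r) g r p * L p).
have [-> | [p0 p0r]] := set_0Vmem (simple_paths r); first by rewrite !big_set0.
case: (arg_minP L p0r) => q qr q_min.
(* Sending the whole demand along a cheapest path [q] separates the two sides. *)
apply: (@le_trans _ _ (demand r * L q)).
  rewrite -f_demand mulr_suml; apply: ler_sum => p pr.
  have := f_ge0 r p pr; rewrite le_eqVlt => /predU1P[<-|fp_gt0].
    by rewrite !mul0r.
  by rewrite ler_pM2l //; apply: f_min.
rewrite -g_demand mulr_suml; apply: ler_sum => p pr.
by apply: ler_wpM2l; [apply: g_ge0 | apply: q_min].
Qed.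

End VariationalInequality.

(* [A] and [B] stand for the linear parts of the latency at equilibrium and at
   the optimum, [x] and [y] for the total flows, [mu] for the smallest slope. *)
Lemma road_bound (R : realFieldType) (k mu b x y A B : R) :
  1 <= k -> 0 <= mu -> 0 <= b -> 0 <= x -> 0 <= y ->
  mu * x <= A -> A <= k * (mu * x) -> mu * y <= B ->
  (k + 1) * (x * (A + b)) - 2 * k * ((x - y) * (A + b + mu * y))
    <= (k + 1) * k * (y * (B + b)).
Proof.
move=> k1 mu0 b0 x0 y0 muA Ak muB.
have k0 : 0 <= k := le_trans ler01 k1.
have A0 : 0 <= A := le_trans (mulr_ge0 mu0 x0) muA.
have amgm : 0 <= x * A - 2 * y * A + k * mu * y ^+ 2.
  (* The argument below multiplies by [x], so [x = 0] is treated apart; there [A] is squeezed to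
     0. *)
  move: x0; rewrite le_eqVlt => /predU1P[x0|x_gt0].
    have mu_y : 0 <= k * mu * y ^+ 2 by rewrite !mulr_ge0 ?sqr_ge0.
    have -> : A = 0.
      by apply/le_anti; rewrite A0 andbT; move: Ak; rewrite -x0 !mulr0.
    by rewrite !mulr0 subr0 add0r.
  (* Times [x], the expression equals [A (x - y)^2 + (k mu x - A) y^2]. *)
  rewrite -(pmulr_rge0 _ x_gt0).
  have : 0 <= A * (x - y) ^+ 2 by rewrite mulr_ge0 ?sqr_ge0.
  have : 0 <= (k * (mu * x) - A) * y ^+ 2 by rewrite mulr_ge0 ?sqr_ge0 ?subr_ge0.
  by lra.
have h1 : 0 <= (k - 1) * (x * A - 2 * y * A + k * mu * y ^+ 2).
  by rewrite mulr_ge0 ?subr_ge0.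
have h2 : 0 <= y * (k * (mu * x) - A) by rewrite mulr_ge0 ?subr_ge0.
have h3 : 0 <= (k + 1) * k * (y * (B - mu * y)).
  by rewrite !mulr_ge0 ?subr_ge0 ?addr_ge0.
have h4 : 0 <= (k - 1) * b * (x + k * y).
  by rewrite !mulr_ge0 ?subr_ge0 // addr_ge0 ?mulr_ge0.
(* Right side minus left side is exactly [h1 + 2 h2 + h3 + h4]. *)
by lra.
Qed.

Section Roads.
Variables (R : realType) (n m : nat) (G : routing_instance R n m).
Local Notation k := (max_asymmetry G).

Lemma max_asymmetry_ge1 : 1 <= k.
Proof. exact: bigmax_ge_id. Qed.

Lemma latency_ge0 (z : 'M[R]_(n, m)) (i : 'I_n) :
  feasible_routing G z -> 0 <= latency G z i.
Proof.
move=> hz; rewrite addr_ge0 ?lat_const_ge0 // sumr_ge0 // => j _.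
by rewrite mulr_ge0 ?lat_slope_ge0 ?(feasible_routing_ge0 _ _ hz).
Qed.

Lemma social_cost_ge0 (z : 'M[R]_(n, m)) :
  feasible_routing G z -> 0 <= social_cost G z.
Proof.
move=> hz; apply: sumr_ge0 => i _; rewrite mulr_ge0 ?latency_ge0 //.
by apply: sumr_ge0 => j _; exact: feasible_routing_ge0 hz.
Qed.

(** Each slope on the road lies between the smallest slope [mu] and [k * mu], and the toll is the
    same for all types, so only total flows matter and [road_bound] applies. *)
Lemma toll_road_bound (z z' : 'M[R]_(n, m)) (i : 'I_n) :
  finite_asymmetry G -> feasible_routing G z -> feasible_routing G z' ->
  (k + 1) * ((\sum_j z i j) * latency G z i)
    - 2 * k * (\sum_j z i j * (latency G z i + toll G z' i j)
               - \sum_j z' i j * (latency G z i + toll G z' i j))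
  <= (k + 1) * k * ((\sum_j z' i j) * latency G z' i).
Proof.
move=> hfin hz hz'.
(* A type [j0] is needed to seed the minimum; without types all sums over types are empty. *)
have [j0 _|no_type] := pickP 'I_m; last first.
  by rewrite !(big_pred0 _ _ _ _ no_type) subr0 !mul0r !mulr0 subr0.
pose mu := \big[Num.min/lat_slope G i j0]_(j < m) lat_slope G i j.
have k_ge1 : 1 <= k := max_asymmetry_ge1.
have k_gt0 : 0 < k := lt_le_trans ltr01 k_ge1.
have mu_ge0 : 0 <= mu.
  by apply: le_bigmin => [|l _]; apply: lat_slope_ge0.
have mu_le j : mu <= lat_slope G i j by apply: bigmin_le.
have le_mu j : lat_slope G i j <= k * mu.
  rewrite -ler_pdivrMl //; apply: le_bigmin => [|l _];
  by rewrite ler_pdivrMl // asymmetry_ratioP.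
(* The minimum in [toll] is seeded at the type [j]; [toll_identical] moves the seed to [j0], giving
   a common factor. *)
have factor (w : 'M[R]_(n, m)) :
    \sum_j w i j * (latency G z i + toll G z' i j) =
    (\sum_j w i j) * (latency G z i + mu * \sum_j z' i j).
  by rewrite mulr_suml; apply: eq_bigr => j _;
  rewrite (toll_identical G z' i j j0).
rewrite !factor -mulrBl; apply: road_bound => //.
- exact: lat_const_ge0.
- by apply: sumr_ge0 => j _; exact: feasible_routing_ge0 hz.
- by apply: sumr_ge0 => j _; exact: feasible_routing_ge0 hz'.
- by rewrite mulr_sumr ler_sum // => j _;
  rewrite ler_wpM2r ?(feasible_routing_ge0 _ _ hz).
- rewrite mulrA mulr_sumr ler_sum // => j _.
  by rewrite ler_wpM2r ?(feasible_routing_ge0 _ _ hz).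
- by rewrite mulr_sumr ler_sum // => j _;
  rewrite ler_wpM2r ?(feasible_routing_ge0 _ _ hz').
Qed.

Lemma toll_equilibrium_cost (z z' : 'M[R]_(n, m)) :
  finite_asymmetry G -> feasible_routing G z' ->
  wardrop_equilibrium G (toll G z') z ->
  social_cost G z <= k * social_cost G z'.
Proof.
move=> hfin hz' heq.
have k_ge1 : 1 <= k := max_asymmetry_ge1.
have k1_gt0 : 0 < k + 1 by lra.
have vi := wardrop_variational_inequality heq hz'.
have hz := wardrop_feasible heq.
(* Scaling by [k + 1] clears the denominator of the multiplier [2k/(k+1)]. *)
rewrite -(ler_pM2l k1_gt0) mulrA.
have : (k + 1) * social_cost G z
    - 2 * k * (\sum_i \sum_j z i j * (latency G z i + toll G z' i j)
               - \sum_i \sum_j z' i j * (latency G z i + toll G z' i j))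
    <= (k + 1) * k * social_cost G z'.
  rewrite /social_cost -sumrB !mulr_sumr -sumrB.
  by apply: ler_sum => i _; apply: toll_road_bound.
(* By [vi] the subtracted term is nonpositive, so dropping it only lowers the left side. *)
apply: le_trans; rewrite lerBrDr gerDl.
by rewrite mulr_ge0_le0 ?subr_le0 //; lra.
Qed.

End Roads.

Theorem theorem3 (R : realType) (n m : nat) (G : routing_instance R n m)
    (zopt zeq : 'M[R]_(n, m))
    (hfin : finite_asymmetry G)
    (hopt : socially_optimal G zopt)
    (heq : wardrop_equilibrium G (toll G zopt) zeq) :
  let k := max_asymmetry G in
  social_cost G zeq <= 4 * k / (3 * k + 1) * k * social_cost G zopt.
Proof.
have [hz _] := hopt; lazy zeta; set k := max_asymmetry G.
apply: le_trans (toll_equilibrium_cost hfin hz heq) _.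
have k_ge1 : 1 <= k := max_asymmetry_ge1 G.
have k_ge0 : 0 <= k := le_trans ler01 k_ge1.
have ratio_ge1 : 1 <= 4 * k / (3 * k + 1).
  by rewrite ler_pdivlMr; lra.
by rewrite ler_wpM2r ?social_cost_ge0 // ler_peMl.
Qed.
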